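(* Let $\Gamma$ and $\Gamma'$ be connected simple graphs on the vertex set $[n]$ and let $\omega\colon\Gamma\to\Gamma'$ be an isomorphism of graphs. Then $\omega$ induces a ring isomorphism of rings of splines $\mathcal{M}_\Gamma\cong\mathcal{M}_{\Gamma'}$ (namely the map $\Omega$ described in the context), and the following equalities of graded symmetric functions hold: $\mathbf{ch}(\mathrm{L}_\Gamma)=\mathbf{ch}(\mathrm{L}_{\Gamma'})$ and $\mathbf{ch}(\mathrm{R}_\Gamma)=\mathbf{ch}(\mathrm{R}_{\Gamma'})$.
   Context: Graphs are finite, undirected, without loops or multiple edges; $[n]=\{1,\dots,n\}$. An edge $(i,j)$ of a graph on $[n]$ is identified with the transposition $(i,j)\in S_n$. Write $\mathbb{C}[t_\bullet]=\mathbb{C}[t_1,\dots,t_n]$; $w\in S_n$ acts on it by $(wf)(t_1,\dots,t_n)=f(t_{w(1)},\dots,t_{w(n)})$. Ring of splines: for a connected graph $\Gamma$ on $[n]$, $\mathcal{M}_\Gamma$ is the set of functions $\bar\rho\colon S_n\to\mathbb{C}[t_\bullet]$ such that $\bar\rho(w)-\bar\rho(w(i,j))\in\langle t_{w(i)}-t_{w(j)}\rangle$ for all $w\in S_n$ and all $(i,j)\in E(\Gamma)$, with pointwise addition and multiplication. It is graded by polynomial degree. The symmetric group acts on $\mathcal{M}_\Gamma$ by the dot action $(w\cdot\bar\rho)(v)=w\,\bar\rho(w^{-1}v)$. Let $\bar t_i,\bar x_i\in\mathcal{M}_\Gamma$ be given by $\bar t_i(w)=t_i$ and $\bar x_i(w)=t_{w(i)}$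 for all $w\in S_n$. Set $\mathrm{L}_\Gamma=\mathcal{M}_\Gamma/\langle\bar t_1,\dots,\bar t_n\rangle$ and $\mathrm{R}_\Gamma=\mathcal{M}_\Gamma/\langle\bar x_1,\dots,\bar x_n\rangle$ (quotients by ideals of the ring $\mathcal{M}_\Gamma$). These are finite-dimensional graded $\mathbb{C}$-vector spaces on which the dot action induces graded $S_n$-representations; $\mathbf{ch}(\mathrm{L}_\Gamma)$ and $\mathbf{ch}(\mathrm{R}_\Gamma)$ denote their graded Frobenius characteristics (the Frobenius characteristic symmetric function of each graded piece, recorded by degree). A graph isomorphism $\omega\colon\Gamma\to\Gamma'$ is a bijection $[n]\to[n]$, hence also an element of $S_n$. The induced map $\Omega\colon\mathcal{M}_\Gamma\to\mathcal{M}_{\Gamma'}$ is $\Omega(\bar\rho)(v)=\omega\,\bar\rho(\omega^{-1}v\omega)$ for $v\in S_n$. *)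

(* Defs.v *)
From HB Require Import structures.
From mathcomp Require Import all_boot all_order all_algebra all_fingroup.
From mathcomp Require Import boolp classical_sets reals complex.
From mathcomp Require Import mpoly ring.

Set Implicit Arguments.
Unset Strict Implicit.
Unset Printing Implicit Defensive.

Import GRing.Theory.
Local Open Scope ring_scope.
Local Open Scope quotient_scope.

(* The vertex set [n] = {1, ..., n} is represented by 'I_n = {0, ..., n-1}. *)
Record sgraph (n : nat) := SGraph {
  adj :> rel 'I_n;
  adj_sym : ssrbool.symmetric adj;
  adj_irr : irreflexive adj }.

Definition connected_graph n (G : sgraph n) : Prop :=
  forall i j : 'I_n, connect (adj G) i j.

Definition graph_iso n (G G' : sgraph n) (om : 'S_n) : Prop :=
  forall i j : 'I_n, adj G' (om i) (om j) = adj G i j.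

(* Product of permutations as composition of functions, right factor first.  *)
(* MathComp's group law on 'S_n composes in the opposite order:              *)
(* (s * t)%g i = t (s i).                                                    *)
Definition pcomp n (s t : 'S_n) : 'S_n := (t * s)%g.

Lemma pcompE n (s t : 'S_n) i : pcomp s t i = s (t i).
Proof. exact: permM. Qed.

(* The action (w f)(t_1, ..., t_n) = f(t_{w(1)}, ..., t_{w(n)}) of S_n on    *)
(* polynomials is msym w f, which substitutes 'X_(w i) for 'X_i.             *)

Section Splines.
Variables (K : numFieldType) (n : nat) (G : sgraph n).

Definition is_spline (rho : 'S_n -> {mpoly K[n]}) : Prop :=
  forall (w : 'S_n) (i j : 'I_n), adj G i j ->
  exists q : {mpoly K[n]},
    rho w - rho (pcomp w (tperm i j)) = q * ('X_(w i) - 'X_(w j)).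

Definition spline_pred : {pred {ffun 'S_n -> {mpoly K[n]}}} :=
  fun rho => `[< is_spline rho >].

Record spline := Spline {
  spline_val :> {ffun 'S_n -> {mpoly K[n]}};
  spline_valP : spline_val \in spline_pred }.

Lemma splineP (f : spline) : is_spline f.
Proof. by case: f => f /= /asboolP. Qed.

HB.instance Definition _ := [isSub for spline_val].
HB.instance Definition _ := [Choice of spline by <:].

Lemma spline_pred_subring : subring_closed spline_pred.
Proof.
split.
- by apply/asboolP=> w i j _; exists 0; rewrite !ffunE subrr mul0r.
- move=> f g /asboolP hf /asboolP hg; apply/asboolP=> w i j eij.
  have [[a ha] [b hb]] := (hf w i j eij, hg w i j eij).
  by exists (a - b); rewrite !ffunE mulrBl -ha -hb; ring.
- move=> f g /asboolP hf /asboolP hg; apply/asboolP=> w i j eij.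
  have [[a ha] [b hb]] := (hf w i j eij, hg w i j eij).
  exists (a * g w + f (pcomp w (tperm i j)) * b); rewrite !ffunE mulrDl.
  by rewrite mulrAC -ha -mulrA -hb; ring.
Qed.

Lemma spline_pred_submod : submod_closed spline_pred.
Proof.
split; first by apply/asboolP=> w i j _; exists 0; rewrite !ffunE subrr mul0r.
move=> c f g /asboolP hf /asboolP hg; apply/asboolP=> w i j eij.
have [[a ha] [b hb]] := (hf w i j eij, hg w i j eij).
exists (c *: a + b); rewrite !ffunE mulrDl -scalerAl -ha -hb scalerBr.
by rewrite opprD addrACA.
Qed.

HB.instance Definition _ := GRing.isSubringClosed.Build _ spline_pred
  spline_pred_subring.
HB.instance Definition _ := GRing.isSubmodClosed.Build K _ spline_pred
  spline_pred_submod.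
HB.instance Definition _ :=
  GRing.SubChoice_isSubPzRing.Build _ _ spline (GRing.subringClosedP _).
HB.instance Definition _ := [SubZmodule_isSubLmodule of spline by <:].

Lemma spline_eqP (f g : spline) : (forall w, f w = g w) -> f = g.
Proof. by move=> fg; apply/val_inj/ffunP. Qed.

Lemma splineDE (f g : spline) w : (f + g) w = f w + g w.
Proof. by rewrite ffunE. Qed.
Lemma splineNE (f : spline) w : (- f) w = - f w.
Proof. by rewrite ffunE. Qed.
Lemma splineME (f g : spline) w : (f * g) w = f w * g w.
Proof. by rewrite ffunE. Qed.
Lemma spline0E w : (0 : spline) w = 0.
Proof. by rewrite ffunE. Qed.
Lemma spline1E w : (1 : spline) w = 1.
Proof. by rewrite ffunE. Qed.
Lemma splineZE c (f : spline) w : (c *: f) w = c *: f w.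
Proof. by rewrite ffunE. Qed.
Lemma spline_sumE I (r : seq I) (P : pred I) (F : I -> spline) w :
  (\sum_(i <- r | P i) F i) w = \sum_(i <- r | P i) F i w.
Proof. by elim/big_rec2: _ => [|i y x _ <-]; rewrite (spline0E, splineDE). Qed.

Lemma spline_mulC : commutative ( *%R : spline -> spline -> spline).
Proof. by move=> f g; apply: spline_eqP => w; rewrite !splineME mulrC. Qed.

Lemma spline_oner_neq0 : (1 : spline) != 0.
Proof.
apply/eqP=> /(congr1 (fun f : spline => f 1%g)); rewrite spline1E spline0E.
by move/eqP; rewrite oner_eq0.
Qed.

HB.instance Definition _ :=
  GRing.PzRing_hasCommutativeMul.Build spline spline_mulC.
HB.instance Definition _ :=
  GRing.PzSemiRing_isNonZero.Build spline spline_oner_neq0.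

Lemma spline_scaleAl c (f g : spline) : c *: (f * g) = (c *: f) * g.
Proof.
apply: spline_eqP => w; rewrite splineZE [in LHS]splineME [in RHS]splineME splineZE.
exact: scalerAl.
Qed.

Definition spline_homog (d : nat) (f : spline) : Prop :=
  forall w, f w \is d.-homog.

Lemma dot_subproof (w : 'S_n) (f : spline) :
  [ffun v : 'S_n => msym w (f (pcomp w^-1%g v))] \in spline_pred.
Proof.
apply/asboolP=> v i j eij; rewrite !ffunE.
have [q hq] := splineP f (pcomp w^-1%g v) eij.
exists (msym w q).
have -> : pcomp w^-1 (pcomp v (tperm i j)) = pcomp (pcomp w^-1 v) (tperm i j).
  by rewrite /pcomp mulgA.
rewrite -msymB hq msymM msymB /msym !mmapX !mmap1U.
by rewrite !pcompE !permKV.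
Qed.

Definition dot (w : 'S_n) (f : spline) : spline := Spline (dot_subproof w f).

Lemma dotE w (f : spline) v : dot w f v = msym w (f (pcomp w^-1%g v)).
Proof. by rewrite ffunE. Qed.

Lemma tbar_subproof (i : 'I_n) : [ffun _ : 'S_n => 'X_i] \in spline_pred.
Proof. by apply/asboolP=> w j k _; exists 0; rewrite !ffunE subrr mul0r. Qed.

Definition tbar (i : 'I_n) : spline := Spline (tbar_subproof i).

Lemma xbar_subproof (k : 'I_n) : [ffun w : 'S_n => 'X_(w k)] \in spline_pred.
Proof.
apply/asboolP=> w i j _; rewrite !ffunE pcompE.
case: tpermP => [->|->|_ _]; first by exists 1; rewrite mul1r.
  by exists (-1); rewrite mulN1r opprB.
by exists 0; rewrite subrr mul0r.
Qed.

Definition xbar (i : 'I_n) : spline := Spline (xbar_subproof i).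

Definition ideal_gen (g : 'I_n -> spline) : {pred spline} :=
  fun f => `[< exists a : 'I_n -> spline, f = \sum_i a i * g i >].

Lemma ideal_gen_idealr (g : 'I_n -> spline) :
  (forall i, (g i 1%g)@_0%MM = 0) -> idealr_closed (ideal_gen g).
Proof.
move=> g0; split.
- by apply/asboolP; exists (fun=> 0); rewrite big1 // => i _; rewrite mul0r.
- apply/asboolP => -[a /(congr1 (fun f : spline => (f 1%g)@_0%MM))].
  rewrite spline1E spline_sumE raddf_sum /= mcoeff1 eqxx big1 => [|i _].
    by move/eqP; rewrite oner_eq0.
  by rewrite splineME rmorphM /= g0 mulr0.
- move=> a u v /asboolP[b ->] /asboolP[c ->]; apply/asboolP.
  exists (fun i => a * b i + c i); rewrite mulr_sumr -big_split /=.
  by apply: eq_bigr => i _; rewrite mulrDl mulrA.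
Qed.

Definition tideal : {pred spline} := ideal_gen tbar.
Definition xideal : {pred spline} := ideal_gen xbar.

Lemma tideal_idealr : idealr_closed tideal.
Proof.
apply: ideal_gen_idealr => i.
by rewrite ffunE mcoeffX; case: eqP => // /eqP; rewrite mnm1_eq0.
Qed.

Lemma xideal_idealr : idealr_closed xideal.
Proof.
apply: ideal_gen_idealr => i.
by rewrite ffunE mcoeffX; case: eqP => // /eqP; rewrite mnm1_eq0.
Qed.

HB.instance Definition _ := isIdealr.Build spline tideal tideal_idealr.
HB.instance Definition _ := isIdealr.Build spline xideal xideal_idealr.

End Splines.

Arguments tideal K {n} G.
Arguments xideal K {n} G.

Section Quotient.
Variables (K : numFieldType) (n : nat) (G : sgraph n) (I : idealr (spline K G)).

Definition spline_quot := {ideal_quot I}.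
HB.instance Definition _ := GRing.ComNzRing.on spline_quot.

Definition quot_pi (f : spline K G) : spline_quot := \pi_{ideal_quot I} f.
Definition quot_repr (x : spline_quot) : spline K G :=
  generic_quotient.repr (x : {ideal_quot I} : Type).

Lemma quot_reprK : cancel quot_repr quot_pi.
Proof. by move=> x; rewrite /quot_pi /quot_repr reprK. Qed.

Lemma quot_piP (f g : spline K G) : quot_pi f = quot_pi g <-> f - g \in I.
Proof.
split=> [/eqP h|h]; first by rewrite (@Quotient.idealrBE _ I).
by apply/eqP; rewrite -[_ == _](@Quotient.idealrBE _ I).
Qed.

Lemma quot_pi_repr (f : spline K G) : quot_repr (quot_pi f) - f \in I.
Proof. by apply/quot_piP; rewrite quot_reprK. Qed.

Lemma idealZ c (f : spline K G) : f \in I -> c *: f \in I.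
Proof.
move=> fI; rewrite -[f]mul1r spline_scaleAl.
exact: idealMr.
Qed.

Definition quot_scale (c : K) (x : spline_quot) : spline_quot :=
  quot_pi (c *: quot_repr x).

Lemma quot_piD : {morph quot_pi : f g / f + g}.
Proof. exact: (rmorphD \pi_{ideal_quot I}). Qed.
Lemma quot_piM : {morph quot_pi : f g / f * g}.
Proof. exact: (rmorphM \pi_{ideal_quot I}). Qed.

Lemma quot_scaleE c f : quot_scale c (quot_pi f) = quot_pi (c *: f).
Proof. by apply/quot_piP; rewrite -scalerBr idealZ // quot_pi_repr. Qed.

Lemma quot_scaleA a b x : quot_scale a (quot_scale b x) = quot_scale (a * b) x.
Proof. by rewrite -[x]quot_reprK !quot_scaleE scalerA. Qed.
Lemma quot_scale1 : left_id 1 quot_scale.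
Proof. by move=> x; rewrite -[x]quot_reprK quot_scaleE scale1r. Qed.
Lemma quot_scaleDr : right_distributive quot_scale +%R.
Proof.
move=> c x y; rewrite -[x]quot_reprK -[y]quot_reprK -quot_piD !quot_scaleE.
by rewrite scalerDr quot_piD.
Qed.
Lemma quot_scaleDl x : {morph quot_scale^~ x : a b / a + b}.
Proof.
by move=> a b; rewrite -[x]quot_reprK /= !quot_scaleE scalerDl quot_piD.
Qed.

HB.instance Definition _ := GRing.Zmodule_isLmodule.Build K spline_quot
  quot_scaleA quot_scale1 quot_scaleDr quot_scaleDl.

Lemma quot_piZ c (f : spline K G) : quot_pi (c *: f) = c *: quot_pi f.
Proof. by rewrite -quot_scaleE. Qed.

(* The degree-d piece of the quotient: the image of the degree-d splines.    *)
Definition deg_piece (d : nat) : set spline_quot :=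
  [set x | exists2 f, spline_homog d f & x = quot_pi f].

(* The action induced on the quotient; the choice of representative is       *)
(* immaterial when the ideal is stable under the dot action (quot_dotE).     *)
Definition quot_dot (w : 'S_n) (x : spline_quot) : spline_quot :=
  quot_pi (dot w (quot_repr x)).

End Quotient.

Arguments deg_piece {K n G} I d _.
Arguments quot_dot {K n G} I w x.

Section Stable.
Variables (K : numFieldType) (n : nat) (G : sgraph n).
Implicit Types f g : spline K G.

Lemma dotD w : {morph @dot K n G w : f g / f + g}.
Proof.
move=> f g; apply: spline_eqP => v; rewrite splineDE !dotE splineDE.
exact: msymD.
Qed.
Lemma dotN w : {morph @dot K n G w : f / - f}.
Proof.
move=> f; apply: spline_eqP => v; rewrite splineNE !dotE splineNE.
exact: msymN.
Qed.
Lemma dotM w : {morph @dot K n G w : f g / f * g}.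
Proof.
move=> f g; apply: spline_eqP => v; rewrite splineME !dotE splineME.
exact: msymM.
Qed.
Lemma dotZ w c f : dot w (c *: f) = c *: dot w f.
Proof.
apply: spline_eqP => v; rewrite splineZE !dotE splineZE.
exact: msymZ.
Qed.
Lemma dot0 w : dot w (0 : spline K G) = 0.
Proof. by rewrite -[X in dot _ X](scale0r (0 : spline K G)) dotZ scale0r. Qed.
Lemma dot_sum w (J : finType) (F : J -> spline K G) :
  dot w (\sum_i F i) = \sum_i dot w (F i).
Proof. exact: (big_morph _ (dotD w) (dot0 w)). Qed.

Lemma dot_pcomp u w f : dot (pcomp u w) f = dot u (dot w f).
Proof.
apply: spline_eqP => v; rewrite !dotE /pcomp msymMm.
by rewrite invMg mulgA.
Qed.
Lemma dot1 f : dot 1 f = f.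
Proof. by apply: spline_eqP => v; rewrite dotE msym1m /pcomp invg1 mulg1. Qed.

Lemma dot_tbar w i : dot w (tbar K G i) = tbar K G (w i).
Proof. by apply: spline_eqP => v; rewrite dotE !ffunE /msym mmapX mmap1U. Qed.
Lemma dot_xbar w i : dot w (xbar K G i) = xbar K G i.
Proof.
apply: spline_eqP => v; rewrite dotE !ffunE /msym mmapX mmap1U.
by rewrite pcompE permKV.
Qed.

Lemma dot_homog d w f : spline_homog d f -> spline_homog d (dot w f).
Proof.
move=> hf v; rewrite dotE homog_piE -msym_pihomog.
by have := hf (pcomp w^-1%g v); rewrite homog_piE => /eqP ->.
Qed.

Lemma tideal_dot w f : f \in tideal K G -> dot w f \in tideal K G.
Proof.
move=> /asboolP[a ->]; apply/asboolP.
exists (fun i => dot w (a (w^-1%g i))); rewrite dot_sum.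
rewrite [RHS](reindex_inj (@perm_inj _ w)) /=; apply: eq_bigr => i _.
by rewrite dotM dot_tbar permK.
Qed.

Lemma xideal_dot w f : f \in xideal K G -> dot w f \in xideal K G.
Proof.
move=> /asboolP[a ->]; apply/asboolP.
exists (fun i => dot w (a i)); rewrite dot_sum; apply: eq_bigr => i _.
by rewrite dotM dot_xbar.
Qed.

Lemma quot_dotE (I : idealr (spline K G)) w f :
  (forall g, g \in I -> dot w g \in I) ->
  quot_dot I w (quot_pi I f) = quot_pi I (dot w f).
Proof.
move=> stab; apply/quot_piP; rewrite -dotN -dotD; apply: stab.
exact: quot_pi_repr.
Qed.

End Stable.

Section Trace.
Variables (K : fieldType) (V : lmodType K).
Implicit Types (U : set V) (f : V -> V).

Definition is_basis U m (b : 'I_m -> V) : Prop :=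
  (forall i, U (b i)) /\
  (forall v, U v -> exists! c : 'rV[K]_m, v = \sum_i c 0 i *: b i).

Definition is_trace U f (t : K) : Prop :=
  exists m (b : 'I_m -> V) (A : 'M[K]_m),
    [/\ is_basis U b, forall i, f (b i) = \sum_j A i j *: b j & t = \tr A].

(* Trace of the restriction of f to the subspace U, computed in any finite   *)
(* basis of U (see trace_onE), and 0 if there is none.                       *)
Definition trace_on U f : K := xget 0 [set t | is_trace U f t].

Definition subspace U : Prop :=
  U 0 /\ forall c u v, U u -> U v -> U (c *: u + v).

Lemma subspace_sum U m (b : 'I_m -> V) (c : 'rV[K]_m) :
  subspace U -> (forall i, U (b i)) -> U (\sum_i c 0 i *: b i).
Proof.
move=> [U0 Ul] Ub; elim/big_rec: _ => // i v _ Uv.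
exact: Ul.
Qed.

Lemma basis_coord_inj U m (b : 'I_m -> V) (c d : 'rV[K]_m) :
  subspace U -> is_basis U b ->
  \sum_i c 0 i *: b i = \sum_i d 0 i *: b i -> c = d.
Proof.
move=> sU [Ub Uc] e; have [c' [_ h]] := Uc _ (subspace_sum c sU Ub).
by rewrite -(h c) // -(h d).
Qed.

Lemma basis_matrix U m m' (b : 'I_m -> V) (v : 'I_m' -> V) :
  is_basis U b -> (forall i, U (v i)) ->
  exists A : 'M[K]_(m', m), forall i, v i = \sum_j A i j *: b j.
Proof.
move=> [_ Uc] Uv.
have /choice[c hc] i : exists c : 'rV[K]_m, v i = \sum_j c 0 j *: b j.
  by have [c [h _]] := Uc _ (Uv i); exists c.
exists (\matrix_(i, j) c i 0 j) => i; rewrite hc.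
by apply: eq_bigr => j _; rewrite mxE.
Qed.

Lemma comb_mulmx m m' m'' (b : 'I_m -> V) (v : 'I_m' -> V)
    (A : 'M[K]_(m', m)) (B : 'M[K]_(m'', m')) i :
  (forall k, v k = \sum_j A k j *: b j) ->
  \sum_k B i k *: v k = \sum_j (B *m A) i j *: b j.
Proof.
move=> hv; under eq_bigr do rewrite hv scaler_sumr.
rewrite exchange_big /=; apply: eq_bigr => j _.
by rewrite mxE scaler_suml; apply: eq_bigr => k _; rewrite scalerA.
Qed.

Lemma is_trace_unique U f s t : subspace U ->
  (forall c u v, f (c *: u + v) = c *: f u + f v) ->
  is_trace U f s -> is_trace U f t -> s = t.
Proof.
move=> sU flin [m [b [A [hb hA ->]]]] [m' [b' [A' [hb' hA' ->]]]].
have f0 : f 0 = 0.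
  have /eqP := flin 1 0 0; rewrite !scale1r addr0.
  by rewrite -subr_eq subrr eq_sym => /eqP.
have [P hP] := basis_matrix hb' (proj1 hb).
have [Q hQ] := basis_matrix hb (proj1 hb').
have uniq_mx r p (e : 'I_p -> V) (B C : 'M[K]_(r, p)) : is_basis U e ->
    (forall i, \sum_j B i j *: e j = \sum_j C i j *: e j) -> B = C.
  move=> he h; apply/row_matrixP => i; apply: (basis_coord_inj sU he).
  by under eq_bigr do rewrite mxE; rewrite h; under [RHS]eq_bigr do rewrite mxE.
have inv1 r p (e : 'I_p -> V) (e' : 'I_r -> V) (B : 'M[K]_(p, r))
      (C : 'M[K]_(r, p)) :
    is_basis U e -> (forall i, e i = \sum_j B i j *: e' j) ->
    (forall i, e' i = \sum_j C i j *: e j) -> B *m C = 1%:M.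
  move=> he hB hC; apply: (uniq_mx _ _ _ _ _ he) => i.
  rewrite -(comb_mulmx B i hC) -hB (bigD1 i) //= mxE eqxx scale1r.
  by rewrite big1 ?addr0 // => j ne; rewrite mxE eq_sym (negPf ne) scale0r.
have QP := inv1 _ _ _ _ _ _ hb' hQ hP; have PQ := inv1 _ _ _ _ _ _ hb hP hQ.
have AP : A *m P = P *m A'.
  apply: (uniq_mx _ _ _ _ _ hb') => i; rewrite -(comb_mulmx A i hP) -hA.
  rewrite -(comb_mulmx P i hA') hP.
  elim/big_rec2: _ => [|j x y _ <-]; first by [].
  by rewrite flin.
by rewrite -[A]mulmx1 -PQ mulmxA AP -mulmxA mxtrace_mulC -mulmxA QP mulmx1.
Qed.

Lemma trace_onE U f t : subspace U ->
  (forall c u v, f (c *: u + v) = c *: f u + f v) ->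
  is_trace U f t -> trace_on U f = t.
Proof.
move=> sU flin ht; apply: (is_trace_unique sU flin) => //.
by rewrite /trace_on; apply: (@xgetPex _ 0 [set t | is_trace U f t]); exists t.
Qed.

Lemma trace_onP U f m (b : 'I_m -> V) : is_basis U b ->
  (forall v, U v -> U (f v)) -> is_trace U f (trace_on U f).
Proof.
move=> hb Uf; apply: (@xgetPex _ 0 [set t | is_trace U f t]).
have [A hA] := basis_matrix hb (fun i => Uf _ (proj1 hb i)).
by exists (\tr A); exists m, b, A.
Qed.

Lemma finite_basis U N : subspace U ->
  (forall b : 'I_N.+1 -> V, (forall i, U (b i)) ->
     exists2 c : 'rV[K]_N.+1, c != 0 & \sum_i c 0 i *: b i = 0) ->
  exists m (b : 'I_m -> V), is_basis U b.
Proof.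
move=> sU hN.
pose fr m (b : 'I_m -> V) :=
  (forall i, U (b i)) /\ (forall c : 'rV[K]_m, \sum_i c 0 i *: b i = 0 -> c = 0).
pose P m := `[< exists b : 'I_m -> V, fr m b >].
have P0 : exists m, P m.
  exists 0%N; apply/asboolP; exists (fun=> 0); split; first by case.
  by move=> c _; apply/rowP; case.
have nPN : ~~ P N.+1.
  apply/asboolP => -[b [Ub fb]]; have [c /eqP nz /fb] := hN b Ub.
  exact: nz.
have Pdown m : P m.+1 -> P m.
  move=> /asboolP[b [Ub fb]]; apply/asboolP.
  exists (fun i => b (lift ord0 i)); split=> // c hc.
  have := fb (\row_i oapp (c 0) 0 (unlift ord0 i)).
  rewrite big_ord_recl mxE unlift_none scale0r add0r.
  under eq_bigr do rewrite mxE liftK /=.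
  move=> /(_ hc) /rowP e; apply/rowP => i.
  by have := e (lift ord0 i); rewrite !mxE liftK.
have Pbd m : P m -> (m <= N)%N.
  move=> Pm; rewrite leqNgt; apply/negP => lt.
  move: Pm; rewrite -(subnK lt); move: (m - N.+1)%N => k.
  by elim: k => [|k IH]; [rewrite add0n (negPf nPN) | rewrite addSn => /Pdown].
case: (ex_maxnP P0 Pbd) => m /asboolP[b [Ub fb]] mmax.
exists m, b; split=> // v Uv.
have uniqc (c d : 'rV[K]_m) :
    \sum_i c 0 i *: b i = \sum_i d 0 i *: b i -> c = d.
  move=> e; apply/subr0_eq/fb.
  under eq_bigr do rewrite !mxE scalerBl.
  by rewrite sumrB e subrr.
suff [c hc] : exists c : 'rV[K]_m, v = \sum_i c 0 i *: b i.
  by exists c; split=> // d hd; apply: uniqc; rewrite -hc -hd.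
have : ~ fr m.+1 (fun i => oapp b v (unlift ord0 i)).
  move=> h; have /mmax : P m.+1 by apply/asboolP; eexists; exact: h.
  by rewrite ltnn.
rewrite /fr => /not_andP[[]|].
  by move=> i; case: (unlift ord0 i).
move=> /existsNP[c /not_implyP[]].
rewrite big_ord_recl unlift_none /=; under eq_bigr do rewrite liftK /=.
move=> hc nz; have c0 : c 0 ord0 != 0.
  apply/eqP => c0; apply: nz.
  move: hc; rewrite c0 scale0r add0r => hc.
  have /rowP e : \row_i c 0 (lift ord0 i) = 0 :> 'rV[K]_m.
    by apply: fb; under eq_bigr do rewrite mxE.
  apply/rowP => i; case: (unliftP ord0 i) => [j|] ->; last by rewrite c0 mxE.
  by have := e j; rewrite !mxE.
exists (\row_i (- (c 0 ord0)^-1 * c 0 (lift ord0 i))).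
under eq_bigr do rewrite mxE -scalerA.
rewrite -scaler_sumr; move: hc => /eqP; rewrite addrC addr_eq0 => /eqP ->.
by rewrite scaleNr scalerN opprK scalerA mulVf // scale1r.
Qed.

End Trace.

Section SymmetricFunctions.
Variables (K : numFieldType).

(* Substitutes 0 for the last of k+1 variables.                              *)
Definition drop_last k (p : {mpoly K[k.+1]}) : {mpoly K[k]} :=
  p \mPo [tuple oapp (fun j : 'I_k => 'X_j) 0 (unlift ord_max i) | i < k.+1].

(* Homogeneous symmetric functions of degree d: the inverse limit over k of  *)
(* the symmetric polynomials homogeneous of degree d in k variables.         *)
Record symfun (d : nat) := SymFun {
  sf_poly :> forall k, {mpoly K[k]};
  sf_sym : forall k, sf_poly k \is symmetric;
  sf_homog : forall k, sf_poly k \is d.-homog;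
  sf_compat : forall k, drop_last (sf_poly k.+1) = sf_poly k }.

Definition psum k r : {mpoly K[k]} := \sum_(i < k) 'X_i ^+ r.

(* The power sum p_lambda in k variables, lambda the cycle type of w.        *)
Definition psum_cycles k n (w : 'S_n) : {mpoly K[k]} :=
  \prod_(c in porbits w) psum k #|c|.

Definition frob_poly n (chi : 'S_n -> K) k : {mpoly K[k]} :=
  n`!%:R^-1 *: \sum_(w : 'S_n) chi w *: psum_cycles k w.

Lemma psum_sym k r : psum k r \is symmetric.
Proof.
apply/issymP => s; rewrite /psum raddf_sum /= [RHS](reindex_inj (@perm_inj _ s)).
by apply: eq_bigr => i _; rewrite rmorphXn /= /msym mmapX mmap1U.
Qed.

Lemma psum_homog k r : psum k r \is r.-homog.
Proof.
apply: rpred_sum => i _; rewrite mpolyXn dhomogX /= mdegMn mdeg1.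
by rewrite mul1n.
Qed.

Lemma drop_last_psum k r : (0 < r)%N -> drop_last (psum k.+1 r) = psum k r.
Proof.
move=> r0; rewrite /drop_last /psum raddf_sum /= big_ord_recr /=.
rewrite !rmorphXn /= comp_mpolyXU -tnth_nth tnth_mktuple unlift_none /=.
rewrite expr0n -[r == 0%N]negbK -lt0n r0 addr0; apply: eq_bigr => i _.
rewrite rmorphXn /= comp_mpolyXU -tnth_nth tnth_mktuple.
have -> : widen_ord (leqnSn k) i = lift ord_max i.
  by apply/val_inj; rewrite [RHS]lift_max.
by rewrite liftK.
Qed.

Lemma porbits_gt0 n (w : 'S_n) c : c \in porbits w -> (0 < #|c|)%N.
Proof. by case/imsetP => x _ ->; apply/card_gt0P; exists x; apply: porbit_id. Qed.

Lemma frob_poly_sym n (chi : 'S_n -> K) k : frob_poly chi k \is symmetric.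
Proof.
apply: rpredZ; apply: rpred_sum => w _; apply: rpredZ.
by apply: rpred_prod => c _; apply: psum_sym.
Qed.

Lemma sum_porbits n (w : 'S_n) : (\sum_(c in porbits w) #|c| = n)%N.
Proof.
have h : finset.partition (porbits w) (finset.setTfor 'I_n).
  have -> : porbits w = orbit 'P <[w]>%g @: finset.setTfor 'I_n.
    apply/setP => c; apply/imsetP/imsetP => -[x _ ->];
      by exists x => //; rewrite ?finset.inE ?porbitE.
  by apply: orbit_partition; apply/actsP => a _ x; rewrite !finset.inE.
by rewrite -(finset.card_partition h) cardsT card_ord.
Qed.

Lemma frob_poly_homog n (chi : 'S_n -> K) k : frob_poly chi k \is n.-homog.
Proof.
apply: rpredZ; apply: rpred_sum => w _; apply: rpredZ.
have h (s : seq {set 'I_n}) :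
    \prod_(c <- s) psum k #|c| \is (\sum_(c <- s) #|c|)%N.-homog.
  elim: s => [|c s IH]; first by rewrite !big_nil dhomog1.
  by rewrite !big_cons dhomogM // psum_homog.
have := h [seq c <- index_enum _ | c \in porbits w].
by rewrite !big_filter sum_porbits.
Qed.

Lemma frob_poly_compat n (chi : 'S_n -> K) k :
  drop_last (frob_poly chi k.+1) = frob_poly chi k.
Proof.
rewrite /drop_last /frob_poly comp_mpolyZ (raddf_sum (comp_mpoly _)) /=; congr (_ *: _).
apply: eq_bigr => w _; rewrite comp_mpolyZ rmorph_prod /=; congr (_ *: _).
by apply: eq_bigr => c /porbits_gt0; apply: drop_last_psum.
Qed.

(* 1/n! * sum_w chi(w) p_(cycle type of w) *)
Definition frob n (chi : 'S_n -> K) : symfun n :=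
  SymFun (frob_poly_sym chi) (frob_poly_homog chi) (frob_poly_compat chi).

End SymmetricFunctions.

Section Characteristics.
Variables (K : numFieldType) (n : nat) (G : sgraph n).

(* A graded symmetric function is recorded as the sequence of its            *)
(* coefficients with respect to the grading degree d.                        *)
Definition gr_ch (I : idealr (spline K G)) : nat -> symfun K n :=
  fun d => frob (fun w => trace_on (deg_piece I d) (quot_dot I w)).

Definition ch_L : nat -> symfun K n := gr_ch (tideal K G).
Definition ch_R : nat -> symfun K n := gr_ch (xideal K G).

End Characteristics.

(* The traces entering gr_ch (tideal K G) and gr_ch (xideal K G) are genuine: *)
(* the degree pieces are finite-dimensional and stable under the action.      *)
Section Genuine.
Variables (K : numFieldType) (n : nat) (G : sgraph n) (I : idealr (spline K G)).

Lemma deg_piece_subspace d : subspace (deg_piece I d).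
Proof.
split=> [|c _ _ [f hf ->] [g hg ->]].
  exists 0; last by rewrite /quot_pi [RHS](rmorph0 \pi_{ideal_quot I}).
  by move=> w; rewrite spline0E dhomog0.
exists (c *: f + g); last by rewrite quot_piD quot_piZ.
move=> w; rewrite splineDE splineZE.
by apply: rpredD; [apply: rpredZ; apply: hf|apply: hg].
Qed.

Lemma deg_piece_basis d :
  exists m (b : 'I_m -> spline_quot I), is_basis (deg_piece I d) b.
Proof.
pose T := ('S_n * 'X_{1..n < d.+1})%type.
apply: (@finite_basis _ _ _ #|{: T}| (deg_piece_subspace d)) => b Ub.
have /choice[f hf] i : exists f, spline_homog d f /\ b i = quot_pi I f.
  by have [f hf e] := Ub i; exists f.
pose M : 'M[K]_(#|{: T}|.+1, #|{: T}|) :=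
  \matrix_(i, j) (f i (enum_val j : T).1)@_((enum_val j : T).2 : 'X_{1..n}).
have kM : kermx M != 0.
  rewrite kermx_eq0 /row_free neq_ltn; apply/orP; left.
  by rewrite ltnS rank_leq_col.
have [c cM c0] := rowV0Pn kM.
exists c => //; have e : \sum_i c 0 i *: f i = 0.
  apply: spline_eqP => w; rewrite spline0E spline_sumE; apply/mpolyP => m.
  rewrite mcoeff0 raddf_sum /=.
  under eq_bigr do rewrite splineZE mcoeffZ.
  have [dm|dm] := eqVneq (mdeg m) d; last first.
    rewrite big1 // => i _; rewrite (dhomog_nemf_coeff _ dm) ?mulr0 //.
    exact: (proj1 (hf i)).
  have lm : (mdeg m < d.+1)%N by rewrite dm.
  have /rowP/(_ (enum_rank (w, BMultinom lm))) := sub_kermxP cM.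
  rewrite !mxE => h0; rewrite -[RHS]h0; apply: eq_bigr => i _.
  by rewrite mxE enum_rankK.
have : quot_pi I (\sum_i c 0 i *: f i) = 0.
  by rewrite e /quot_pi [LHS](rmorph0 \pi_{ideal_quot I}).
have -> : quot_pi I (\sum_i c 0 i *: f i) = \sum_i c 0 i *: quot_pi I (f i).
  rewrite (big_morph _ (@quot_piD _ _ _ I) (rmorph0 \pi_{ideal_quot I})).
  by apply: eq_bigr => i _; rewrite quot_piZ.
by move=> h0; rewrite -[RHS]h0; apply: eq_bigr => i _; rewrite (proj2 (hf i)).
Qed.

Hypothesis stab : forall w f, f \in I -> dot w f \in I.

Lemma quot_dot_linear w c x y :
  quot_dot I w (c *: x + y) = c *: quot_dot I w x + quot_dot I w y.
Proof.
rewrite -[x]quot_reprK -[y]quot_reprK -quot_piZ -quot_piD.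
rewrite !(quot_dotE _ (stab w)) dotD dotZ.
by rewrite quot_piD quot_piZ.
Qed.

Lemma deg_piece_dot d w x : deg_piece I d x -> deg_piece I d (quot_dot I w x).
Proof.
move=> [f hf ->]; exists (dot w f); first exact: dot_homog.
exact: quot_dotE (stab w).
Qed.

Lemma deg_piece_trace d w t :
  is_trace (deg_piece I d) (quot_dot I w) t <->
  trace_on (deg_piece I d) (quot_dot I w) = t.
Proof.
split=> [|<-].
  by apply: trace_onE; [apply: deg_piece_subspace|apply: quot_dot_linear].
have [m [b hb]] := deg_piece_basis d.
by apply: (trace_onP hb) => v; apply: deg_piece_dot.
Qed.

End Genuine.

Definition induced (K : numFieldType) n (G : sgraph n) (om : 'S_n)
    (rho : spline K G) (v : 'S_n) : {mpoly K[n]} :=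
  msym om (rho (pcomp om^-1%g (pcomp v om))).

(* Main.v *)
(** The map [Omega] is the right translation [rho |-> rho (_ om)] followed by
    the dot action of [om] on [M_G'].  Right translation commutes with the dot
    action, fixes every [tbar i], and sends [xbar i] to [xbar (om i)].  It is
    therefore an equivariant graded isomorphism [L_G -> L_G'] and
    [R_G -> R_G'], so the characters themselves agree, with no conjugation by
    [om], and hence so do the Frobenius characteristics. *)
Require Import Defs.
From HB Require Import structures.
From mathcomp Require Import all_boot all_order all_algebra all_fingroup.
From mathcomp Require Import boolp classical_sets reals complex.
From mathcomp Require Import mpoly.

Set Implicit Arguments.
Unset Strict Implicit.
Unset Printing Implicit Defensive.

Import GRing.Theory.
Local Open Scope ring_scope.

(* [pcomp] from ssrfun (Kleisli composition) would otherwise take precedence. *)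
Local Notation pcomp := Defs.pcomp.

(** * Traces under a linear bijection intertwining two endomaps *)

Section TraceTransfer.
Variables (K : fieldType) (V V' : lmodType K).
Variables (U : set V) (U' : set V') (f : V -> V) (f' : V' -> V').
Variables (phi : {linear V -> V'}) (psi : V' -> V).
Hypotheses (phiK : cancel phi psi) (psiK : cancel psi phi).
Hypotheses (phiU : forall v, U v -> U' (phi v))
           (psiU : forall v, U' v -> U (psi v)).
Hypothesis phif : forall v, phi (f v) = f' (phi v).

Lemma phi_comb m (b : 'I_m -> V) (c : 'I_m -> K) :
  phi (\sum_i c i *: b i) = \sum_i c i *: phi (b i).
Proof. by rewrite linear_sum; apply: eq_bigr => i _; rewrite linearZ. Qed.

(** The coordinates of [v] in [phi \o b] are those of [psi v] in [b]. *)
Lemma is_basis_transfer m (b : 'I_m -> V) :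
  is_basis U b -> is_basis U' (phi \o b).
Proof.
move=> [Ub Uc]; split=> [i|v /psiU /Uc[c [e uc]]]; first exact/phiU/Ub.
exists c; split=> [|d ed]; first by rewrite -phi_comb -e psiK.
by apply: uc; rewrite ed -phi_comb phiK.
Qed.

(** The same matrix [A] represents [f] in [b] and [f'] in [phi \o b]. *)
Lemma is_trace_transfer t : is_trace U f t -> is_trace U' f' t.
Proof.
move=> [m [b [A [hb hA ->]]]]; exists m, (phi \o b), A; split=> //.
  exact: is_basis_transfer.
by move=> i /=; rewrite -phif hA phi_comb.
Qed.

End TraceTransfer.

Lemma graph_iso_inv n (G G' : sgraph n) (om : 'S_n) :
  graph_iso G G' om -> graph_iso G' G om^-1%g.
Proof. by move=> iso i j; rewrite -iso !permKV. Qed.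

(** * Right translation of splines *)

Section RightTranslation.
Variables (K : numFieldType) (n : nat).
Implicit Types (G : sgraph n) (om : 'S_n).

Lemma rtrans_subproof G G' om (iso : graph_iso G G' om) (f : spline K G) :
  [ffun v : 'S_n => f (pcomp v om)] \in @spline_pred K n G'.
Proof.
apply/asboolP=> v i j eij; rewrite !ffunE.
have eij' : adj G (om^-1%g i) (om^-1%g j) by rewrite (graph_iso_inv iso).
have [q] := splineP f (pcomp v om) eij'; rewrite !pcompE !permKV => eq.
exists q; rewrite -eq; congr (_ - f _).
(* In function order, [(i j) om = om (om^-1 i, om^-1 j)]: an edge of [G'] at [v] becomes an edge of
   [G] at [v om], with the same linear form. *)
by rewrite /pcomp -tpermJ /conjg invgK -!mulgA mulKg.
Qed.

Definition rtrans G G' om (iso : graph_iso G G' om) (f : spline K G) :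
  spline K G' := Spline (rtrans_subproof iso f).

Lemma rtransE G G' om (iso : graph_iso G G' om) f v :
  rtrans iso f v = f (pcomp v om).
Proof. by rewrite ffunE. Qed.

Lemma rtransK G G' om (iso : graph_iso G G' om) (iso' : graph_iso G' G om^-1%g) :
  cancel (rtrans iso) (rtrans iso').
Proof.
by move=> f; apply: spline_eqP => v; rewrite !rtransE /pcomp mulKVg.
Qed.

(** Not an instance of [rtransK]: that would require an isomorphism over [om^-1^-1], which is not
    convertible to [om]. *)
Lemma rtransKV G G' om (iso : graph_iso G G' om)
    (iso' : graph_iso G' G om^-1%g) :
  cancel (rtrans iso') (rtrans iso).
Proof.
by move=> f; apply: spline_eqP => v; rewrite !rtransE /pcomp mulKg.
Qed.

Section Morphism.
Variables (G G' : sgraph n) (om : 'S_n) (iso : graph_iso G G' om).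
Local Notation T := (rtrans iso).

Lemma rtransD : {morph T : f g / f + g}.
Proof.
by move=> f g; apply: spline_eqP => v; rewrite splineDE !rtransE splineDE.
Qed.
Lemma rtransB : {morph T : f g / f - g}.
Proof.
move=> f g; apply: spline_eqP => v.
by rewrite splineDE splineNE !rtransE splineDE splineNE.
Qed.
Lemma rtransM : {morph T : f g / f * g}.
Proof.
by move=> f g; apply: spline_eqP => v; rewrite splineME !rtransE splineME.
Qed.
Lemma rtrans0 : T 0 = 0.
Proof. by apply: spline_eqP => v; rewrite rtransE !spline0E. Qed.
Lemma rtransZ c f : T (c *: f) = c *: T f.
Proof. by apply: spline_eqP => v; rewrite splineZE !rtransE splineZE. Qed.
Lemma rtrans_sum (J : finType) (F : J -> spline K G) :
  T (\sum_i F i) = \sum_i T (F i).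
Proof. exact: (big_morph _ rtransD rtrans0). Qed.

Lemma rtrans_tbar i : T (tbar K G i) = tbar K G' i.
Proof. by apply: spline_eqP => v; rewrite rtransE !ffunE. Qed.
Lemma rtrans_xbar i : T (xbar K G i) = xbar K G' (om i).
Proof. by apply: spline_eqP => v; rewrite rtransE !ffunE pcompE. Qed.

(** The dot action multiplies the argument on the left and [T] on the right, so associativity
    suffices. *)
Lemma rtrans_dot w f : T (dot w f) = dot w (T f).
Proof.
by apply: spline_eqP => v; rewrite dotE !rtransE dotE /pcomp mulgA.
Qed.

Lemma rtrans_homog d f : spline_homog d f -> spline_homog d (T f).
Proof. by move=> hf v; rewrite rtransE. Qed.

Lemma rtrans_tideal f : f \in tideal K G -> T f \in tideal K G'.
Proof.
move=> /asboolP[a ->]; apply/asboolP; exists (T \o a).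
by rewrite rtrans_sum; apply: eq_bigr => i _; rewrite rtransM rtrans_tbar.
Qed.

Lemma rtrans_xideal f : f \in xideal K G -> T f \in xideal K G'.
Proof.
(* [T] permutes the generators by [om], so the coefficient of [xbar i] comes from index
   [om^-1 i]. *)
move=> /asboolP[a ->]; apply/asboolP; exists (fun i => T (a (om^-1%g i))).
rewrite rtrans_sum [RHS](reindex_inj (@perm_inj _ om)) /=.
by apply: eq_bigr => i _; rewrite rtransM rtrans_xbar permK.
Qed.

End Morphism.

(** * Descent of right translation to the quotients *)

Section QuotientMap.
Variables (G G' : sgraph n) (om : 'S_n) (iso : graph_iso G G' om).
Variables (I : idealr (spline K G)) (I' : idealr (spline K G')).
Hypothesis TI : forall f, f \in I -> rtrans iso f \in I'.

(* The proof argument is computationally irrelevant; the linear instance below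
   reads it off the term. *)
Definition quot_rtrans of (forall f, f \in I -> rtrans iso f \in I') :=
  fun x : spline_quot I => quot_pi I' (rtrans iso (quot_repr x)).

Lemma quot_rtransE f :
  quot_rtrans TI (quot_pi I f) = quot_pi I' (rtrans iso f).
Proof. by apply/quot_piP; rewrite -rtransB TI // quot_pi_repr. Qed.

Lemma quot_rtrans_linear : linear (quot_rtrans TI).
Proof.
move=> c x y; rewrite -[x]quot_reprK -[y]quot_reprK -quot_piZ -quot_piD.
by rewrite !quot_rtransE rtransD rtransZ quot_piD quot_piZ.
Qed.

HB.instance Definition _ := GRing.isLinear.Build K (spline_quot I)
  (spline_quot I') *:%R (quot_rtrans TI) quot_rtrans_linear.

Definition quot_rtrans_lin : {linear spline_quot I -> spline_quot I'} :=
  quot_rtrans TI.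

Lemma quot_rtrans_deg_piece d x :
  deg_piece I d x -> deg_piece I' d (quot_rtrans TI x).
Proof.
move=> [f hf ->]; exists (rtrans iso f); first exact: rtrans_homog.
exact: quot_rtransE.
Qed.

Lemma quot_rtrans_dot w x :
  (forall g, g \in I' -> dot w g \in I') ->
  quot_rtrans TI (quot_dot I w x) = quot_dot I' w (quot_rtrans TI x).
Proof.
(* [quot_dot] and [quot_rtrans] both unfold to a [quot_pi], so the computation rules apply up to
   conversion. *)
by move=> stab; rewrite quot_rtransE (quot_dotE _ stab) rtrans_dot.
Qed.

End QuotientMap.

(** * Equality of graded characters *)

Section Characters.
Variables (G G' : sgraph n) (om : 'S_n).
Variables (iso : graph_iso G G' om) (iso' : graph_iso G' G om^-1%g).
Variables (I : idealr (spline K G)) (I' : idealr (spline K G')).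
Hypotheses (TI : forall f, f \in I -> rtrans iso f \in I')
           (TI' : forall f, f \in I' -> rtrans iso' f \in I).
Hypotheses (stab : forall w f, f \in I -> dot w f \in I)
           (stab' : forall w f, f \in I' -> dot w f \in I').

Lemma quot_rtransK : cancel (quot_rtrans TI) (quot_rtrans TI').
Proof. by move=> x; rewrite quot_rtransE rtransK quot_reprK. Qed.

Lemma quot_rtransKV : cancel (quot_rtrans TI') (quot_rtrans TI).
Proof. by move=> x; rewrite quot_rtransE rtransKV quot_reprK. Qed.

Lemma eq_trace_quot d w :
  trace_on (deg_piece I d) (quot_dot I w) =
  trace_on (deg_piece I' d) (quot_dot I' w).
Proof.
(* Both traces are picked by [xget] with default 0, so it is enough that the two sets of traces
   coincide; each inclusion uses one of the two inverse maps. *)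
congr xget; apply/seteqP; split=> t /=.
  apply: (@is_trace_transfer _ _ _ _ _ _ _ (quot_rtrans_lin TI)
    _ quot_rtransK quot_rtransKV).
  - exact: quot_rtrans_deg_piece.
  - exact: quot_rtrans_deg_piece.
  - by move=> x; apply: quot_rtrans_dot; apply: stab'.
apply: (@is_trace_transfer _ _ _ _ _ _ _ (quot_rtrans_lin TI')
  _ quot_rtransKV quot_rtransK).
- exact: quot_rtrans_deg_piece.
- exact: quot_rtrans_deg_piece.
- by move=> x; apply: quot_rtrans_dot; apply: stab.
Qed.

Lemma eq_gr_ch : gr_ch I = gr_ch I'.
Proof.
by apply/funext => d; congr frob; apply/funext => w; apply: eq_trace_quot.
Qed.

End Characters.

Lemma ch_L_iso G G' om : graph_iso G G' om -> ch_L K G = ch_L K G'.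
Proof.
move=> iso; apply: (@eq_gr_ch _ _ _ iso (graph_iso_inv iso)).
- exact: rtrans_tideal.
- exact: rtrans_tideal.
- exact: tideal_dot.
- exact: tideal_dot.
Qed.

Lemma ch_R_iso G G' om : graph_iso G G' om -> ch_R K G = ch_R K G'.
Proof.
move=> iso; apply: (@eq_gr_ch _ _ _ iso (graph_iso_inv iso)).
- exact: rtrans_xideal.
- exact: rtrans_xideal.
- exact: xideal_dot.
- exact: xideal_dot.
Qed.

(** * The ring isomorphism of splines *)

Section InducedMap.
Variables (G G' : sgraph n) (om : 'S_n) (iso : graph_iso G G' om).

Definition induced_map (f : spline K G) : spline K G' := dot om (rtrans iso f).

Lemma induced_mapE f v : induced_map f v = induced om f v.
Proof. by rewrite dotE rtransE /induced /pcomp mulgA. Qed.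

Lemma induced_map_zmod : zmod_morphism induced_map.
Proof. by move=> f g; rewrite /induced_map rtransB dotD dotN. Qed.

Lemma induced_map_monoid : monoid_morphism induced_map.
Proof.
split=> [|f g]; last by rewrite /induced_map rtransM dotM.
apply: spline_eqP => v; rewrite dotE rtransE !spline1E.
exact: rmorph1.
Qed.

HB.instance Definition _ := GRing.isZmodMorphism.Build (spline K G)
  (spline K G') induced_map induced_map_zmod.
HB.instance Definition _ := GRing.isMonoidMorphism.Build (spline K G)
  (spline K G') induced_map induced_map_monoid.

Definition induced_rmorphism : {rmorphism spline K G -> spline K G'} :=
  induced_map.

Lemma induced_map_bij : bijective induced_map.
Proof.
(* The inverse undoes the two factors in reverse order. *)
exists (fun f => rtrans (graph_iso_inv iso) (dot om^-1%g f)) => f.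
  by rewrite /induced_map -dot_pcomp /pcomp mulgV dot1 rtransK.
by rewrite /induced_map rtransKV -dot_pcomp /pcomp mulVg dot1.
Qed.

End InducedMap.

End RightTranslation.

Theorem lemmaA (R : realType) (n : nat) (G G' : sgraph n) (om : 'S_n)
    (connG : connected_graph G) (connG' : connected_graph G')
    (isoG : graph_iso G G' om) :
  (exists Om : {rmorphism spline R[i] G -> spline R[i] G'},
     bijective Om /\
     forall (rho : spline R[i] G) (v : 'S_n), Om rho v = induced om rho v) /\
  ch_L R[i] G = ch_L R[i] G' /\
  ch_R R[i] G = ch_R R[i] G'.
Proof.
split; last by split; [apply: ch_L_iso isoG|apply: ch_R_iso isoG].
exists (induced_rmorphism _ isoG); split; first exact: induced_map_bij.
exact: induced_mapE.
Qed.
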